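(* Let $d\in\{2,3\}$, let $c_1,\dots,c_d>0$, and for unit vectors $g_1,\dots,g_d\in\mathbb{R}^d$ (so the number of sensors is $n=d$) let $G=\sum_{i=1}^d c_i^2 g_ig_i^T$. Then $$\|G\|^2\ \ge\ \sum_{i=1}^d c_i^4 ,$$ and this lower bound is achieved by $\{g_i\}_{i=1}^d$ (i.e. equality holds) if and only if $\{g_i\}_{i=1}^d$ is an orthogonal basis of $\mathbb{R}^d$.
   Context: $\|\cdot\|$ is the Frobenius norm of a matrix. *)

(* Defs.v *)
From HB Require Import structures.
From mathcomp Require Import all_boot all_order all_algebra.
From mathcomp Require Import reals.

Set Implicit Arguments.
Unset Strict Implicit.
Unset Printing Implicit Defensive.

Import Order.TTheory GRing.Theory Num.Theory.
Local Open Scope ring_scope.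

(* The norm `|A| that MathComp-Analysis puts on matrices is the sup norm, and
   spectral.v has a dot product only over numClosedFieldType; hence the
   definitions below. *)

Definition frobenius_norm (R : realType) (m n : nat) (A : 'M[R]_(m, n)) : R :=
  Num.sqrt (\sum_(i < m) \sum_(j < n) A i j ^+ 2).

Definition dot (R : realType) (d : nat) (u v : 'cV[R]_d) : R :=
  \sum_(k < d) u k 0 * v k 0.

Definition euclidean_norm (R : realType) (d : nat) (v : 'cV[R]_d) : R :=
  Num.sqrt (dot v v).

Definition weighted_gram (R : realType) (d n : nat)
    (c : 'I_n -> R) (g : 'I_n -> 'cV[R]_d) : 'M[R]_d :=
  \sum_(i < n) c i ^+ 2 *: (g i *m (g i)^T).

Definition orthogonal_basis (R : realType) (d n : nat)
    (g : 'I_n -> 'cV[R]_d) : Prop :=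
  basis_of fullv [seq g i | i <- enum 'I_n] /\
  (forall i j : 'I_n, i != j -> dot (g i) (g j) = 0).

(* Main.v *)
Require Import Defs.
From mathcomp Require Import all_boot all_order all_algebra.
From mathcomp Require Import reals.

Import Order.TTheory GRing.Theory Num.Theory.
Local Open Scope ring_scope.

(** [||G||^2 = \sum_(i, j) c_i^2 c_j^2 <g_i, g_j>^2]: the diagonal terms add up
    to [\sum_i c_i^4], and the off-diagonal ones are nonnegative and all vanish
    exactly when the [g_i] are pairwise orthogonal. *)

Lemma sqr_frobenius_norm (R : realType) (m n : nat) (A : 'M[R]_(m, n)) :
  frobenius_norm A ^+ 2 = \sum_(i < m) \sum_(j < n) A i j ^+ 2.
Proof.
by rewrite sqr_sqrtr // sumr_ge0 // => i _; rewrite sumr_ge0 // => j _;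
  rewrite sqr_ge0.
Qed.

Lemma dot_suml (R : realType) (d n : nat) (k : 'I_n -> R)
    (g : 'I_n -> 'cV[R]_d) (v : 'cV[R]_d) :
  dot (\sum_(i < n) k i *: g i) v = \sum_(i < n) k i * dot (g i) v.
Proof.
under [RHS]eq_bigr => i _ do rewrite /dot mulr_sumr.
rewrite exchange_big /=; apply: eq_bigr => l _.
by rewrite summxE mulr_suml; apply: eq_bigr => i _; rewrite mxE mulrA.
Qed.

Lemma dot_unit (R : realType) (d : nat) (v : 'cV[R]_d) :
  euclidean_norm v = 1 -> dot v v = 1.
Proof.
move=> hv; have v_ge0 : 0 <= dot v v.
  by rewrite sumr_ge0 // => k _; rewrite -expr2 sqr_ge0.
by rewrite -(sqr_sqrtr v_ge0) -/(euclidean_norm v) hv expr1n.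
Qed.

Lemma weighted_gramE (R : realType) (d n : nat) (c : 'I_n -> R)
    (g : 'I_n -> 'cV[R]_d) (k l : 'I_d) :
  weighted_gram c g k l = \sum_(i < n) c i ^+ 2 * (g i k 0 * g i l 0).
Proof.
rewrite summxE; apply: eq_bigr => i _.
by rewrite !mxE big_ord1 mxE.
Qed.

(** Squaring an entry [(k, l)] of the matrix gives a double sum over pairs of sensors [(i, j)]. With
    [i] and [j] fixed, the sum over [k] and [l] factors into two equal sums, each being
    [dot (g i) (g j)]. *)
Lemma sqr_frobenius_weighted_gram (R : realType) (d n : nat) (c : 'I_n -> R)
    (g : 'I_n -> 'cV[R]_d) :
  frobenius_norm (weighted_gram c g) ^+ 2 =
  \sum_(i < n) \sum_(j < n) (c i * c j * dot (g i) (g j)) ^+ 2.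
Proof.
rewrite sqr_frobenius_norm.
transitivity (\sum_(k < d) \sum_(l < d) \sum_(i < n) \sum_(j < n)
   (c i * c j) ^+ 2 * ((g i k 0 * g j k 0) * (g i l 0 * g j l 0))).
  apply: eq_bigr => k _; apply: eq_bigr => l _.
  rewrite weighted_gramE expr2 mulr_suml; apply: eq_bigr => i _.
  rewrite mulr_sumr; apply: eq_bigr => j _.
  by rewrite mulrACA -exprMn [X in _ * X]mulrACA.
(* The sensor index [i] is moved outside [l], then outside [k]; the same two exchanges are then made
   for [j]. *)
under eq_bigr => k _ do rewrite exchange_big.
rewrite exchange_big; apply: eq_bigr => i _ /=.
under eq_bigr => k _ do rewrite exchange_big.
rewrite exchange_big; apply: eq_bigr => j _ /=.
rewrite [RHS]exprMn [X in _ = _ * X]expr2 mulr_suml mulr_sumr.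
by apply: eq_bigr => k _; rewrite !mulr_sumr.
Qed.

Lemma sqr_frobenius_weighted_gram_unit (R : realType) (d n : nat)
    (c : 'I_n -> R) (g : 'I_n -> 'cV[R]_d) :
  (forall i, euclidean_norm (g i) = 1) ->
  frobenius_norm (weighted_gram c g) ^+ 2 =
  \sum_(i < n) c i ^+ 4 +
  \sum_(i < n) \sum_(j < n | j != i) (c i * c j * dot (g i) (g j)) ^+ 2.
Proof.
move=> hg; rewrite sqr_frobenius_weighted_gram -big_split /=.
apply: eq_bigr => i _; rewrite (bigD1 i) //=; congr (_ + _).
by rewrite dot_unit // mulr1 -expr2 -exprM.
Qed.

(** There are as many vectors as the dimension, so freeness suffices. Pairing a vanishing
    combination with [g j] leaves only the coefficient [k j]. *)
Lemma orthonormal_basis (R : realType) (d : nat) (g : 'I_d -> 'cV[R]_d) :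
  (forall i, euclidean_norm (g i) = 1) ->
  (forall i j, i != j -> dot (g i) (g j) = 0) ->
  basis_of fullv [seq g i | i <- enum 'I_d].
Proof.
move=> hg ortho.
rewrite basisEfree subvf size_map size_enum_ord dimvf /dim /= muln1 leqnn !andbT.
(* The family is written as a tuple to match [freeP]; its underlying sequence is convertible to the
   mapped enumeration in the goal. *)
have /freeP free_g : forall k : 'I_d -> R,
    \sum_(i < d) k i *: [tuple g i | i < d]`_i = 0 -> forall i, k i = 0.
  move=> k sum0 j.
  have {}sum0 : \sum_(i < d) k i *: g i = 0.
    rewrite -[RHS]sum0; apply: eq_bigr => i _.
    by rewrite -tnth_nth tnth_mktuple.
  have : dot (\sum_(i < d) k i *: g i) (g j) = 0.
    by rewrite sum0 /dot big1 // => l _; rewrite mxE mul0r.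
  rewrite dot_suml (bigD1 j) //= dot_unit // mulr1 big1 ?addr0 // => i ij.
  by rewrite ortho ?mulr0.
exact: free_g.
Qed.

Theorem mainTheorem4 (R : realType) (d : nat) (hd : d = 2%N \/ d = 3%N)
    (c : 'I_d -> R) (hc : forall i : 'I_d, 0 < c i)
    (g : 'I_d -> 'cV[R]_d) (hg : forall i : 'I_d, euclidean_norm (g i) = 1) :
  \sum_(i < d) c i ^+ 4 <= frobenius_norm (weighted_gram c g) ^+ 2 /\
  (frobenius_norm (weighted_gram c g) ^+ 2 = \sum_(i < d) c i ^+ 4 <->
   orthogonal_basis g).
Proof.
rewrite sqr_frobenius_weighted_gram_unit //.
have row_ge0 i : 0 <= \sum_(j < d | j != i) (c i * c j * dot (g i) (g j)) ^+ 2.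
  by apply: sumr_ge0 => j _; apply: sqr_ge0.
split; first by rewrite lerDl sumr_ge0.
split=> [sum_eq | [_ ortho]]; last first.
  rewrite [X in _ + X]big1 ?addr0 // => i _; rewrite big1 // => j ji.
  by rewrite ortho 1?eq_sym // mulr0 expr0n.
(* Unit norms turn pairwise orthogonality into the basis property. *)
suff ortho i j : i != j -> dot (g i) (g j) = 0.
  by split=> //; apply: orthonormal_basis.
move=> ij; have /eqP := sum_eq.
(* Cancelling the sum of the [c i ^+ 4] leaves a zero sum of nonnegative rows, so row [i] vanishes,
   and then its term [j] does too. *)
rewrite -subr_eq0 addrC addKr psumr_eq0 // => /allP /(_ i).
rewrite mem_index_enum /= => /(_ isT).
rewrite psumr_eq0 => [/allP /(_ j)|l _]; last exact: sqr_ge0.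
rewrite mem_index_enum eq_sym ij /= => /(_ isT).
(* The weights are positive, so the vanishing factor is the dot product. *)
by rewrite expf_eq0 /= !mulf_eq0 !(gt_eqF (hc _)) /= => /eqP.
Qed.
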